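(* Let $n\ge 3$ and $d<n$, and let $F:\{0,1\}^n\to\{0,1\}^n$ be a bijective automata network of degree at most $d$ which is centralized. Then $F$ has an even number of limit cycles.
   Context: An automata network is a map $F:\{0,1\}^V\to\{0,1\}^V$, $V=\{1,\dots,n\}$, with local functions $f_j(x)=F(x)_j$. Its interaction graph $G(F)$ has an arc $(i,j)$ iff $f_j$ effectively depends on $x_i$ (there exist $x,x'$ differing only at $i$ with $f_j(x)\neq f_j(x')$). The degree of $F$ is the maximum in-degree of $G(F)$. $F$ is centralized if $G(F)$ has a node whose deletion leaves the graph acyclic. For a bijection, the limit cycles are the cycles of the permutation $F$ (fixed points count as cycles of length $1$). *)

(* Defs.v *)
(* Built on the Mathematical Components library. *)
From mathcomp Require Import all_boot all_fingroup.

Set Implicit Arguments.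
Unset Strict Implicit.
Unset Printing Implicit Defensive.

Notation config n := {ffun 'I_n -> bool}.

Definition differ_only_at n (i : 'I_n) (x y : config n) : bool :=
  [forall k, (x k != y k) == (k == i)].

(* interaction_graph F i j is the arc (i, j). *)
Definition interaction_graph n (F : config n -> config n) : rel 'I_n :=
  fun i j => [exists x : config n, exists y : config n,
    differ_only_at i x y && (F x j != F y j)].

Definition in_degree (T : finType) (e : rel T) (j : T) : nat :=
  #|[set i | e i j]|.

Definition degree n (F : config n -> config n) : nat :=
  \max_(j < n) in_degree (interaction_graph F) j.

(* A directed cycle is a nonempty cyclic sequence of distinct vertices;
   a loop is a cycle of length 1. *)
Definition acyclic (T : eqType) (e : rel T) : Prop :=
  forall c : seq T, ucycle e c -> c = [::].

Definition delete_vertex (T : eqType) (e : rel T) (v : T) :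
    rel {i : T | i != v} :=
  fun i j => e (val i) (val j).
Arguments delete_vertex {T} e v.

Definition centralized n (F : config n -> config n) : Prop :=
  exists v : 'I_n, acyclic (delete_vertex (interaction_graph F) v).

(* The orbits of F seen as a permutation; fixed points give singletons. *)
Definition limit_cycles n (F : config n -> config n) (bijF : bijective F) :
    {set {set config n}} :=
  porbits (perm (bij_inj bijF)).

(* Main.v *)
(** A permutation has an even number of orbits on a set of even size iff it is
    even, so the point is that [F] is an even permutation of the cube.
    List the vertices as v_0, v_1, ..., v_(n-1), where v_0 is the center and the
    rest is in topological order, and read off coordinate v_k of the output at
    position v_(k-1) (cyclically).  This permutation of the coordinates is even
    since n >= 3, and what remains is a triangular bijection, hence a composite
    of bijections that each modify a single coordinate i.  Since d < n, the new
    value of coordinate i ignores some coordinate c, and c <> i by injectivity;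
    such a step preserves coordinate c and commutes with flipping it, so it is
    the product of two conjugate permutations, hence even. *)
Require Import Defs.
From mathcomp Require Import all_boot all_fingroup.

Set Implicit Arguments.
Unset Strict Implicit.
Unset Printing Implicit Defensive.

Local Open Scope group_scope.

(** [half] is [s] on [A] and the identity elsewhere. As [u] exchanges [A] with its complement and
    commutes with [s], conjugating [half] by [u] gives [s] off [A]. *)
Lemma even_perm_swapped_halves (T : finType) (A : pred T) (s u : {perm T}) :
    (forall x, A (s x) = A x) -> (forall x, A (u x) = ~~ A x) ->
    commute s u -> ~~ odd_perm s.
Proof.
move=> sA uA su.
have sux x : s (u x) = u (s x) by rewrite -!permM su.
pose half x := if A x then s x else x.
have half_inj : injective half.
  move=> x y; rewrite /half; case: ifP => Ax; case: ifP => Ay exy //.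
  - exact: perm_inj exy.
  - by rewrite -exy sA Ax in Ay.
  - by rewrite exy sA Ay in Ax.
suff -> : s = perm half_inj * perm half_inj ^ u.
  by rewrite odd_permM odd_permJ addbb.
apply/permP=> x; rewrite /conjg !permM !(permE half_inj) /half.
have uVA y : A (u^-1 y) = ~~ A y by rewrite -{2}(permKV u y) uA negbK.
by case Ax: (A x) => /=; rewrite uVA ?sA Ax /= ?permKV // -sux permKV.
Qed.

Definition flip n (c : 'I_n) (x : config n) : config n :=
  [ffun k => x k (+) (k == c)].

Lemma flipK n (c : 'I_n) : involutive (flip c).
Proof. by move=> x; apply/ffunP=> k; rewrite !ffunE addbK. Qed.

Lemma even_perm_commuting_flip n (c : 'I_n) (s : {perm config n}) :
    (forall x, s x c = x c) -> (forall x, s (flip c x) = flip c (s x)) ->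
  ~~ odd_perm s.
Proof.
move=> sc sflip.
apply: (@even_perm_swapped_halves _ (fun x : config n => x c) s
          (perm (inv_inj (@flipK n c)))) => [//|x|].
  by rewrite permE ffunE eqxx addbT.
by apply/permP=> x; rewrite !permM !permE sflip.
Qed.

Section CoordinatePermutations.

Variable n : nat.

Definition reindex_config (p : 'S_n) (x : config n) : config n :=
  [ffun j => x (p j)].

Lemma reindex_config_inj p : injective (reindex_config p).
Proof.
move=> x y exy; apply/ffunP=> j.
by move/ffunP/(_ (p^-1 j)): exy; rewrite !ffunE permKV.
Qed.

Definition reindex_perm p : {perm config n} := perm (@reindex_config_inj p).

Lemma reindex_perm1 : reindex_perm 1 = 1.
Proof. by apply/permP=> x; apply/ffunP=> j; rewrite permE ffunE !perm1. Qed.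

Lemma reindex_permM p q : reindex_perm (p * q) = reindex_perm q * reindex_perm p.
Proof.
by apply/permP=> x; apply/ffunP=> j; rewrite permM !permE !ffunE permM.
Qed.

Lemma even_reindex_tperm (i j : 'I_n) :
  3 <= n -> ~~ odd_perm (reindex_perm (tperm i j)).
Proof.
move=> n3.
(* A third coordinate, untouched by the transposition; this is where [3 <= n] enters. *)
have [c /norP[ci cj]] : exists c, ~~ ((c == i) || (c == j)).
  apply/existsP; rewrite -negb_forall; apply: contraL n3 => /forallP all_ij.
  have /subset_leq_card : [set: 'I_n] \subset [set i; j].
    by apply/subsetP=> c _; rewrite !inE.
  rewrite cardsT card_ord cards2 -ltnNge => /leq_ltn_trans-> //.
  by case: (i != j).
apply: (@even_perm_commuting_flip n c) => x.
  by rewrite permE ffunE tpermD // eq_sym.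
apply/ffunP=> k; rewrite !permE !ffunE; congr (_ (+) _).
by rewrite -{1}(tpermD (x := i) (y := j) (z := c)) 1?eq_sym // (inj_eq perm_inj).
Qed.

Lemma even_reindex_perm p : 3 <= n -> ~~ odd_perm (reindex_perm p).
Proof.
move=> n3; case: (prod_tpermP p) => ts -> _.
elim: ts => [|t ts IH]; first by rewrite big_nil reindex_perm1 odd_perm1.
rewrite big_cons reindex_permM odd_permM (negbTE IH).
exact: even_reindex_tperm.
Qed.

End CoordinatePermutations.

Section Triangular.

Variables (n : nat) (r : 'I_n -> nat) (H : config n -> config n).
Hypotheses (r_inj : injective r) (H_inj : injective H).
Hypothesis H_triangular : forall i (x y : config n),
  (forall j, r j <= r i -> x j = y j) -> H x i = H y i.

(** Interpolates between the identity ([k = 0]) and [H] ([k] above all ranks). *)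
Definition truncation k (x : config n) : config n :=
  [ffun i => if r i < k then H x i else x i].

Lemma truncation_inj k : injective (truncation k).
Proof.
pose g (y : config n) : config n :=
  [ffun i => if r i < k then invF H_inj y i else y i].
(* A right inverse suffices on a finite type. Below rank [k], [H] reads only coordinates where [g y]
   agrees with the preimage of [y] under [H]. *)
suff gK : cancel g (truncation k) by apply: (can_inj (canF_sym gK)).
move=> y; apply/ffunP=> i; rewrite !ffunE; case: ifP => [ik|->//].
rewrite -{2}(f_invF H_inj y); apply: H_triangular => j ji.
by rewrite ffunE (leq_ltn_trans ji ik).
Qed.

Definition coordinate_step i (x : config n) : config n :=
  [ffun j => if j == i then H x i else x j].

(** Coordinates of rank below [r i] do not read [i], so coordinate [i] may be updated first. *)
Lemma truncationS i (x : config n) :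
  truncation (r i).+1 x = truncation (r i) (coordinate_step i x).
Proof.
apply/ffunP=> j; rewrite !ffunE ltnS.
case: (ltngtP (r j) (r i)) => [ji|ij|/r_inj->]; last by rewrite eqxx.
- apply: H_triangular => k kj; rewrite ffunE; case: eqP => // ki.
  by move: (leq_ltn_trans kj ji); rewrite ki ltnn.
- by case: eqP => // eji; rewrite eji ltnn in ij.
Qed.

Lemma coordinate_step_inj i : injective (coordinate_step i).
Proof.
move=> x y exy; apply: (@truncation_inj (r i).+1).
by rewrite !truncationS exy.
Qed.

Lemma even_coordinate_step i c :
    (forall x, H (flip c x) i = H x i) ->
  ~~ odd_perm (perm (@coordinate_step_inj i)).
Proof.
move=> Hc.
(* Otherwise the step would overwrite the flipped coordinate and merge [x] with [flip c x]. *)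
have ci : c != i.
  apply/eqP=> ci; pose x : config n := [ffun=> false].
  have /coordinate_step_inj/ffunP/(_ c) :
      coordinate_step i (flip c x) = coordinate_step i x.
    by apply/ffunP=> j; rewrite !ffunE Hc ci; case: eqP; rewrite ?addbF.
  by rewrite !ffunE eqxx.
apply: (@even_perm_commuting_flip n c) => x.
  by rewrite permE ffunE (negbTE ci).
apply/ffunP=> j; rewrite !permE !ffunE Hc.
by have [->|//] := eqVneq j i; rewrite eq_sym (negbTE ci) addbF.
Qed.

Lemma even_triangular :
  (forall i, exists c, forall x, H (flip c x) i = H x i) ->
  ~~ odd_perm (perm H_inj).
Proof.
move=> H_missing.
have even_trunc k : ~~ odd_perm (perm (@truncation_inj k)).
  elim: k => [|k IH].
    suff -> : perm (@truncation_inj 0) = 1 by rewrite odd_perm1.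
    by apply/permP=> x; apply/ffunP=> i; rewrite permE ffunE perm1.
  have [/existsP[i /eqP rik]|/existsPn no_i] := boolP [exists i, r i == k].
    have [c Hc] := H_missing i.
    suff -> : perm (@truncation_inj k.+1) =
        perm (@coordinate_step_inj i) * perm (@truncation_inj k).
      by rewrite odd_permM (negbTE IH) addbF (even_coordinate_step Hc).
    by apply/permP=> x; rewrite permM !permE -rik truncationS.
  (* Ranks may have gaps: here no coordinate has rank [k]. *)
  suff -> : perm (@truncation_inj k.+1) = perm (@truncation_inj k) by [].
  apply/permP=> x; apply/ffunP=> i; rewrite !permE !ffunE ltnS leq_eqVlt.
  by rewrite (negbTE (no_i i)).
suff -> : perm H_inj = perm (@truncation_inj (\max_i r i).+1) by [].
apply/permP=> x; apply/ffunP=> i.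
by rewrite !permE ffunE ltnS leq_bigmax.
Qed.

End Triangular.

(** Rank a vertex by its number of ancestors, itself included. Along an arc from [x] to [y] the
    ancestors grow, strictly because a path from [y] back to [x] would close a cycle. *)
Lemma acyclic_rank (T : finType) (e : rel T) :
  acyclic e -> exists rk : T -> nat, forall x y, e x y -> rk x < rk y.
Proof.
move=> e_acyclic; exists (fun x => #|[set z | connect e z x]|) => x y exy.
apply/proper_card/properP; split.
  apply/subsetP=> z; rewrite !inE => zx.
  exact: connect_trans zx (connect1 exy).
exists y; rewrite inE ?connect0 //; apply/negP=> /connectP[p yp xp].
move: xp; case/shortenP: yp => q yq uq _ xq.
suff /e_acyclic : ucycle e (y :: q) by [].
by rewrite /ucycle /= rcons_path yq -xq exy.
Qed.

(** Sorting by [key] breaks ties; the rank is the position in the sorted list. *)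
Lemma injective_rank n (T : finType) (key : T -> nat) : #|T| = n ->
  exists2 r : T -> 'I_n, injective r &
    forall x y, key x < key y -> r x < r y.
Proof.
move=> <-{n}.
pose s := sort (relpre key leq) (enum T).
have mem_s x : x \in s by rewrite mem_sort mem_enum.
have size_s : size s = #|T| by rewrite size_sort cardE.
have idx x : index x s < #|T| by rewrite -size_s index_mem.
exists (fun x => Ordinal (idx x)) => [x y [] exy | x y kxy /=].
  by rewrite -(nth_index x (mem_s x)) exy nth_index.
rewrite ltnNge; apply/negP=> le_yx; move: kxy; apply/negP; rewrite -leqNgt.
have s_sorted : sorted (relpre key leq) s.
  by apply: sort_sorted => a b; apply: leq_total.
have tr : transitive (relpre key leq) by move=> b a c /=; apply: leq_trans.
by apply: (sorted_leq_index tr _ s_sorted) => // a /=.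
Qed.

Lemma centralized_rank m (F : config m.+1 -> config m.+1) :
    centralized F ->
  exists2 r : 'I_m.+1 -> 'I_m.+1, injective r &
    forall i j, interaction_graph F i j -> r j != ord0 -> r i < r j.
Proof.
case=> v /acyclic_rank[rk rkP].
(* The center gets key 0 and all others a positive key, so the center comes first; arcs into it are
   the ones exempted. *)
pose key (i : 'I_m.+1) := if insub i is Some u then (rk u).+1 else 0.
have [r r_inj rP] := injective_rank key (card_ord m.+1).
have key_v : key v = 0 by rewrite /key insubF ?eqxx.
have keyN i (iv : i != v) : key i = (rk (Sub i iv)).+1.
  by rewrite /key insubT.
have rv0 : r v = ord0.
  have [g _ gK] := injF_bij r_inj.
  have [<-|g0v] := eqVneq (g ord0) v; first exact: gK.
  have : r v < r (g ord0) by apply: rP; rewrite key_v keyN.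
  by rewrite gK.
exists r => // i j eij; have [->|jv] := eqVneq j v; first by rewrite rv0 eqxx.
move=> _; apply: rP; rewrite (keyN j jv).
have [->|iv] := eqVneq i v; first by rewrite key_v.
by rewrite (keyN i iv) ltnS; apply: rkP.
Qed.

(** Arcs only record the effect of single flips, so [x] is turned into [y] one coordinate at a time,
    by induction on their Hamming distance. *)
Lemma eq_local_function n (F : config n -> config n) j (x y : config n) :
  (forall i, interaction_graph F i j -> x i = y i) -> F x j = F y j.
Proof.
have [k] := ubnP #|[set i | x i != y i]|; elim: k x => // k IH x.
rewrite ltnS => card_xy exy.
have [/existsP[i xyi]|/existsPn eq_xy] := boolP [exists i, x i != y i]; last first.
  by congr (F _ j); apply/ffunP=> i; apply/eqP; rewrite -[_ == _]negbK.
have -> : F x j = F (flip i x) j.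
  apply/eqP/contraT=> Fxj; rewrite -(negbTE xyi); apply/eqP/exy.
  apply/existsP; exists x; apply/existsP; exists (flip i x).
  rewrite Fxj andbT; apply/forallP=> l; rewrite ffunE.
  by case: (x l); case: (l == i).
have flip_ne l : (flip i x l != y l) = (l != i) && (x l != y l).
  rewrite ffunE; have [->|] := eqVneq l i; last by rewrite addbF.
  by move: xyi; case: (x i); case: (y i).
apply: IH => [|l /exy xyl]; last first.
  by apply/eqP/contraT; rewrite flip_ne xyl eqxx andbF.
apply: leq_trans card_xy; apply/proper_card/properP; split.
  by apply/subsetP=> l; rewrite !inE flip_ne => /andP[].
by exists i; rewrite !inE ?flip_ne ?eqxx.
Qed.

Lemma missing_input n (F : config n -> config n) j :
  degree F < n -> exists c, ~~ interaction_graph F c j.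
Proof.
move=> degF; apply/existsP; rewrite -negb_forall; apply: contraL degF.
move=> /forallP all_in; rewrite -leqNgt.
apply: leq_trans (leq_bigmax j); rewrite /in_degree.
rewrite (_ : [set i | _] = setT) ?cardsT ?card_ord //.
by apply/setP=> i; rewrite !inE all_in.
Qed.

Theorem theorem5 (n d : nat) (F : config n -> config n) (bijF : bijective F) :
  3 <= n -> d < n -> degree F <= d -> centralized F ->
  ~~ odd #|limit_cycles bijF|.
Proof.
move=> n3 dn degF cenF.
suff : ~~ odd_perm (perm (bij_inj bijF)).
  rewrite /odd_perm /limit_cycles card_ffun card_bool card_ord oddX.
  by rewrite gtn_eqF // (leq_trans _ n3).
have {dn degF} degF := leq_ltn_trans degF dn.
case: n F bijF n3 degF cenF => // m F bijF n3 degF /centralized_rank[r r_inj rP].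
pose rp := perm r_inj.
have ordS_inj : injective (@ordS m.+1) := bij_inj (@ordS_bij _).
(* The cyclic successor in rank order; the last vertex is sent to the center. *)
pose nxt : 'S_m.+1 := rp * perm ordS_inj * rp^-1.
have r_nxt i : r (nxt i) = ordS (r i).
  by rewrite -(permE r_inj (nxt i)) !permM permKV !permE.
pose H (x : config m.+1) := reindex_config nxt (F x).
have H_inj : injective H by move=> x y /reindex_config_inj/(bij_inj bijF).
have -> : perm (bij_inj bijF) = perm H_inj * reindex_perm nxt^-1.
  apply/permP=> x; apply/ffunP=> j; rewrite permM !permE !ffunE.
  by rewrite permKV.
rewrite odd_permM (negbTE (even_reindex_perm _ n3)) addbF.
apply: (@even_triangular _ (fun i => r i)) => [i j /val_inj/r_inj //||i].
  move=> i x y exy; rewrite !ffunE; apply: eq_local_function => j eij.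
  apply: exy; have := rP _ _ eij; rewrite r_nxt.
  (* At the last rank, [nxt i] is the center and may read everything. Otherwise its inputs have rank
     below [r i + 1], hence at most [r i]. *)
  have [->|r_last] := eqVneq (r i) ord_max; first by rewrite leq_ord.
  have r_lt : (r i).+1 < m.+1.
    by rewrite ltn_neqAle ltn_ord andbT eqSS.
  by rewrite -val_eqE /= modn_small // ltnS; apply.
(* Coordinate [i] of [H] is the local function of [nxt i], so the missing input is sought there. *)
have [c noarc] := missing_input (nxt i) degF.
exists c => x; rewrite !ffunE; apply: eq_local_function => j ej.
rewrite ffunE; case: eqP => [jc|_]; last by rewrite addbF.
by rewrite jc (negbTE noarc) in ej.
Qed.
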